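(* Let $y,z$ be indeterminates and let $(A_{n,k})$ be defined by $A_{0,0}=1$, $A_{0,k}=0$ for $k>0$, and for $n\ge1$, $A_{n,k}=A_{n-1,k-1}+yA_{n-1,k}+zA_{n-1,k+1}$ for all $k\ge 0$ (with $A_{n-1,-1}=0$). Use the convention $A_{n,k}=0$ whenever $n<0$, $k<0$ or $k>n$. Then for any integers $m,n,r$ with $m\ge n\ge 0$, $$\sum_{k=0}^{m} z^k\,\mathrm{per}\begin{pmatrix} A_{n,k} & A_{n+r,k+1}\\ A_{m,k} & A_{m+r,k+1}\end{pmatrix}=A_{m+n+r,1}+H_{n,m}(r),$$ where $H_{n,m}(r)=\sum_{i=0}^{r-1}A_{n+i,0}A_{m+r-i-1,0}$ if $r\ge 1$, $H_{n,m}(0)=0$, and $H_{n,m}(r)=-\sum_{i=1}^{|r|}A_{n-i,0}A_{m-|r|+i-1,0}$ if $r\le -1$.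
   Context: $\mathrm{per}$ denotes the permanent: $\mathrm{per}\begin{pmatrix}a&b\\c&d\end{pmatrix}=ad+bc$. The array $(A_{n,k})$ is the recursive matrix with $\sigma=(y,y,y,\ldots)$, $\tau=(z,z,z,\ldots)$. *)

(* Defs.v *)
From HB Require Import structures.
From mathcomp Require Import all_boot all_order all_fingroup all_algebra.
From mathcomp Require Export mpoly.

Set Implicit Arguments.
Unset Strict Implicit.
Unset Printing Implicit Defensive.

Import Order.TTheory GRing.Theory Num.Theory.
Local Open Scope ring_scope.

Section Permanent.
Variable R : comNzRingType.

Definition permanent (n : nat) (M : 'M[R]_n) : R :=
  \sum_(s : 'S_n) \prod_(i < n) M i (s i).

Definition mx22 (a b c d : R) : 'M[R]_2 :=
  \matrix_(i, j) if i == 0 then (if j == 0 then a else b)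
                 else (if j == 0 then c else d).

Lemma permanent_mx22 (a b c d : R) :
  permanent (mx22 a b c d) = a * d + b * c.
Proof.
rewrite /permanent (bigD1 1%g) //= (bigD1 (tperm (0 : 'I_2) 1)) /=; last first.
  by apply/eqP => /permP /(_ 0); rewrite tpermL perm1.
rewrite [X in _ + (_ + X)]big1 => [|s /andP[s1 st]]; last first.
  case/negP: st; apply/eqP/permP => i.
  have s0 : s 0 = 1.
    case E: (s 0) => [[|[|]] //= lt]; last exact/val_inj.
    case/negP: s1; apply/eqP/permP => j; rewrite perm1.
    have {}E : s 0 = 0 by rewrite E; apply/val_inj.
    case: (altP (j =P 0)) => [-> //|j0].
    have : s j != 0 by rewrite -E (inj_eq perm_inj).
    by case: j (s j) j0 => [[|[|]] //= ?] [[|[|]] //= ?] _ _; apply/val_inj.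
  have s1' : s 1 = 0.
    have : s 1 != 1 by rewrite -{2}s0 (inj_eq perm_inj).
    by case: (s 1) => [[|[|]] //= ?] _; apply/val_inj.
  case: (altP (i =P 0)) => [->|i0]; first by rewrite tpermL s0.
  have -> : i = 1 by case: i i0 => [[|[|]] //= ?] _; apply/val_inj.
  by rewrite tpermR s1'.
rewrite addr0 !big_ord_recl !big_ord0 !perm1 !mulr1.
have -> : lift ord0 ord0 = 1 :> 'I_2 by apply/val_inj.
by rewrite tpermL tpermR !mxE.
Qed.

End Permanent.

Section RecursiveMatrix.
Variables (R : comNzRingType) (y z : R).

Fixpoint recmx_nat (n k : nat) {struct n} : R :=
  match n with
  | 0 => (k == 0%N)%:R
  | n'.+1 => (if k is k'.+1 then recmx_nat n' k' else 0)
             + y * recmx_nat n' k + z * recmx_nat n' k.+1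
  end.

(* The remaining convention, A_{n,k} = 0 for k > n, follows from the
   recurrence: see [recmx_gt]. *)
Definition recmx (n k : int) : R :=
  match n, k with
  | Posz n', Posz k' => recmx_nat n' k'
  | _, _ => 0
  end.

Lemma recmx_nat_gt (n k : nat) : (n < k)%N -> recmx_nat n k = 0.
Proof.
elim: n k => [|n IHn] [|k] //= ltnk.
have lt1 : (n < k.+1)%N by exact: ltnW.
have lt2 : (n < k.+2)%N by exact: ltnW.
by rewrite !IHn // !mulr0 !addr0.
Qed.

Lemma recmx_gt (n k : int) : n < k -> recmx n k = 0.
Proof. by case: n k => [n|n] [k|k] //= ltnk; rewrite recmx_nat_gt. Qed.

Lemma recmx_rec (n k : int) : 1 <= n -> 0 <= k ->
  recmx n k = recmx (n - 1) (k - 1) + y * recmx (n - 1) k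
              + z * recmx (n - 1) (k + 1).
Proof.
case: n => [[|n]|n] //; case: k => [k|k] // _ _.
have -> : n.+1%:Z - 1 = n by rewrite -addn1 PoszD addrK.
have -> : k%:Z + 1 = k.+1 by rewrite -addn1.
by case: k => [|k] //=; rewrite subn1.
Qed.

Definition recmx_H (n m r : int) : R :=
  if 1 <= r then
    \sum_(0 <= i < `|r|%N) recmx (n + i%:Z) 0 * recmx (m + r - i%:Z - 1) 0
  else if r == 0 then 0
  else - \sum_(1 <= i < `|r|%N.+1)
           recmx (n - i%:Z) 0 * recmx (m - `|r| + i%:Z - 1) 0.

End RecursiveMatrix.

(* Main.v *)
Require Import Defs.
From mathcomp Require Import all_boot all_order all_algebra mpoly.
From mathcomp Require Import zify ring.
Import Order.TTheory GRing.Theory Num.Theory.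
Local Open Scope ring_scope.

(** Put [S a b = \sum_k z^k A_{a,k} A_{b,k+1}], so that the left-hand side is
    [S n (m + r) + S m (n + r)].  The recurrence operator on rows is self-adjoint
    for the weights [z^k] and commutes with the shift [k |-> k + 1] up to a
    rank-one term, whence [S a (b + 1) = S (a + 1) b + A_{a,0} A_{b,0}].  This law
    gives [S a b + S b a = A_{a+b,1}] by induction from [S 0 b = A_{b,1}] and
    [S b 0 = 0]; applied [|r|] times to [S n (m + r)] it produces
    [S (n + r) m] plus the correction [H_{n,m}(r)].  When [n + r < 0] the law is
    applied only [n] times, ending at [S 0 (m + n + r)], while [S m (n + r)] and
    the remaining terms of [H_{n,m}(r)] vanish. *)

Section ShiftedProduct.
Variables (R : comNzRingType) (y z : R).

Local Notation N := (recmx_nat y z).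
Local Notation A := (recmx y z).

Definition shift_prod (a : nat) (b : int) : R :=
  \sum_(0 <= k < a.+1) z ^+ k * (A a k%:Z * A b (k%:Z + 1)).

Lemma shift_prod_widen (a K : nat) (b : int) : (a < K)%N ->
  \sum_(0 <= k < K) z ^+ k * (A a k%:Z * A b (k%:Z + 1)) = shift_prod a b.
Proof.
move=> aK; rewrite /shift_prod (@big_cat_nat _ _ _ a.+1 0 K) //=.
rewrite [X in _ + X]big_nat_cond [X in _ + X]big1 ?addr0 //.
by move=> k /andP[/andP[ak _] _]; rewrite recmx_nat_gt // mul0r mulr0.
Qed.

Lemma shift_prod_neg (a b : nat) : shift_prod a (Negz b) = 0.
Proof. by rewrite /shift_prod big1 // => k _; rewrite /= !mulr0. Qed.

Lemma shift_prod_n0 (a : nat) : shift_prod a 0 = 0.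
Proof.
rewrite /shift_prod big1 // => k _.
by rewrite [A 0 _]recmx_gt ?mulr0 //; lia.
Qed.

Lemma shift_prod_0n (b : int) : shift_prod 0 b = A b 1.
Proof. by rewrite /shift_prod big_nat1 /= expr0 !mul1r add0r. Qed.

(** After expanding both recurrences the [y] terms cancel and the rest telescopes, leaving
    [N a 0 * N b 0] at the bottom and the last summand at the cutoff. *)
Lemma shift_prod_partial (a b K : nat) :
  \sum_(0 <= k < K.+1) z ^+ k * (N a k * N b.+1 k.+1)
  = \sum_(0 <= k < K.+1) z ^+ k * (N a.+1 k * N b k.+1) + N a 0 * N b 0
    + z ^+ K.+1 * (N a K * N b K.+2 - N a K.+1 * N b K.+1).
Proof.
elim: K => [|K IH]; first by rewrite !big_nat1 /= !expr0 expr1; ring.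
rewrite !(@big_nat_recr _ _ _ K.+1) //= IH /= !exprS; ring.
Qed.

Lemma shift_prodS (a : nat) (b : int) :
  shift_prod a (b + 1) = shift_prod a.+1 b + A a 0 * A b 0.
Proof.
(* For [b < 0] every term vanishes; when [b + 1 = 0] this is because row 0 is zero in the columns
   [k + 1]. *)
case: b => [b|[|b]]; last 2 first.
- by rewrite shift_prod_n0 shift_prod_neg /= mulr0 addr0.
- have -> : Negz b.+1 + 1 = Negz b by lia.
  by rewrite !shift_prod_neg /= mulr0 addr0.
have -> : b%:Z + 1 = b.+1%:Z by lia.
(* A common cutoff past rows [a] and [a.+1], which kills the boundary term. *)
have a1K : (a.+1 < (a + b).+2.+1)%N by lia.
rewrite -(@shift_prod_widen a.+1 (a + b).+2.+1) //.
rewrite -(@shift_prod_widen a (a + b).+2.+1) ?(ltnW a1K) //.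
under eq_bigr => k _ do rewrite -PoszD addn1.
under [in RHS]eq_bigr => k _ do rewrite -PoszD addn1.
rewrite [LHS]shift_prod_partial.
rewrite (@recmx_nat_gt _ _ _ a (a + b).+2) // (@recmx_nat_gt _ _ _ a (a + b).+3).
  by rewrite !mul0r subrr mulr0 addr0.
exact: ltnW.
Qed.

Lemma shift_prod_sym (a b : nat) :
  shift_prod a b%:Z + shift_prod b a%:Z = A (a%:Z + b%:Z) 1.
Proof.
elim: a b => [|a IH] b; first by rewrite shift_prod_n0 shift_prod_0n addr0 add0r.
have -> : a.+1%:Z = a%:Z + 1 by lia.
(* The correction [A a 0 * A b 0] is symmetric, so it occurs on both sides and cancels. *)
have := IH b.+1; have -> : b.+1%:Z = b%:Z + 1 by lia.
rewrite !shift_prodS => E.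
have -> : a%:Z + 1 + b%:Z = a%:Z + (b%:Z + 1) by lia.
by rewrite -E; ring.
Qed.

Lemma shift_prod_iter (a s : nat) (b : int) :
  shift_prod a (b + s%:Z) = shift_prod (a + s) b
    + \sum_(0 <= i < s) A (a%:Z + i%:Z) 0 * A (b + s%:Z - i%:Z - 1) 0.
Proof.
elim: s a => [|s IH] a; first by rewrite big_nil !addr0 addn0.
have -> : b + s.+1%:Z = b + s%:Z + 1 by lia.
rewrite shift_prodS IH addSnnS big_nat_recl // -!addrA; congr (_ + _).
rewrite addrC; congr (_ * _ + _); [by congr (A _ _); lia..|].
by apply: eq_bigr => i _; congr (A _ _ * A _ _); lia.
Qed.

Lemma shift_prod_sum (n m : nat) (r : int) :
  shift_prod n (m%:Z + r) + shift_prod m (n%:Z + r)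
  = A (m%:Z + n%:Z + r) 1 + recmx_H y z n m r.
Proof.
case: r => [r|s].
  have -> : recmx_H y z n m r
    = \sum_(0 <= i < r) A (n%:Z + i%:Z) 0 * A (m%:Z + r%:Z - i%:Z - 1) 0.
    by rewrite /recmx_H; case: r => [|r] //=; rewrite big_nil.
  rewrite shift_prod_iter addrAC -PoszD shift_prod_sym.
  by congr (A _ _ + _); lia.
have [{}s -> s0] : exists2 t : nat, Negz s = - t%:Z & (0 < t)%N.
  by exists s.+1 => //; lia.
(* Reversing the summation order gives the sum of [shift_prod_iter] started at row [n - s]. *)
have -> : recmx_H y z n m (- s%:Z)
   = - \sum_(0 <= i < s) A (n%:Z - s%:Z + i%:Z) 0 * A (m%:Z - i%:Z - 1) 0.
  rewrite /recmx_H; have /negbTE -> : ~~ (1 <= - s%:Z) by lia.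
  have /negbTE -> : - s%:Z != 0 by lia.
  rewrite normrN abszN /= big_add1 /=.
  rewrite big_nat_rev /= add0n; congr (- _).
  rewrite !big_nat; apply: eq_bigr => i /andP[_ is_].
  by congr (A _ _ * A _ _); lia.
have [sn|ns] := leqP s n.
  have En : n%:Z - s%:Z = (n - s)%N%:Z by lia.
  rewrite En; have := shift_prod_iter (n - s) s (m%:Z - s%:Z).
  rewrite subrK subnK // => E.
  have -> : m%:Z + n%:Z - s%:Z = (n - s)%N%:Z + m%:Z by lia.
  by rewrite -shift_prod_sym E; ring.
have -> : n%:Z - s%:Z = Negz (s - n).-1 by lia.
rewrite shift_prod_neg addr0.
have := shift_prod_iter 0 n (m%:Z - s%:Z).
rewrite shift_prod_0n add0n => E.
have -> : m%:Z + n%:Z - s%:Z = m%:Z - s%:Z + n%:Z by lia.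
rewrite E (@big_cat_nat _ _ _ (s - n) 0 s) ?leq_subr //.
(* For [i < s - n] the row [n - s + i] is negative; the remaining [n] terms match [E] after a shift
   by [s - n]. *)
rewrite [X in _ - (X + _)]big_nat_cond [X in _ - (X + _)]big1 ?add0r; last first.
  move=> i /andP[/andP[_ isn] _].
  have -> : Negz (s - n).-1 + i%:Z = Negz (s - n - i).-1 by lia.
  by rewrite mul0r.
rewrite -[X in \sum_(X <= _ < s) _]add0n big_addn subKn ?(ltnW ns) //.
apply/eqP; rewrite -addrA addrC -subr_eq subrr eq_sym subr_eq0; apply/eqP.
by apply: eq_bigr => i _; congr (A _ _ * A _ _); lia.
Qed.

End ShiftedProduct.

Theorem theorem1p4 (R : comNzRingType) (m n r : int) :
  0 <= n -> n <= m ->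
  let y : {mpoly R[2]} := 'X_0 in
  let z : {mpoly R[2]} := 'X_1 in
  let A := recmx y z in
  \sum_(0 <= k < `|m|%N.+1)
     z ^+ k * permanent (mx22 (A n k%:Z)  (A (n + r) (k%:Z + 1))
                              (A m k%:Z)  (A (m + r) (k%:Z + 1)))
  = A (m + n + r) 1 + recmx_H y z n m r.
Proof.
case: n => [n|//] _; case: m => [m|//] nm y z A.
(* Since [n <= m], both products can be summed over [k <= m]. *)
rewrite -shift_prod_sum -(@shift_prod_widen _ y z n m.+1) ?ltnS //.
rewrite -big_split /=; apply: eq_bigr => k _.
by rewrite permanent_mx22 mulrDr [A (n%:Z + r) _ * _]mulrC.
Qed.
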